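(* Let $q$ be a complex number with $0<|q|<1$. For all nonnegative integers $m$, $$\sum_{\substack{k\ge 0\\ k\ne m}} {2k \brack k}_{q^2}\,\frac{q^k}{(-q;q)_{2k}\,[k-m]_{q^2}} = {2m \brack m}_{q^2}\,\frac{(1+q)\,q^m}{(-q;q)_{2m}} \sum_{k\ge 2m+1} \frac{(-1)^{k-1} q^k}{[k]_q}.$$
   Context: For a base $p$ (here $p=q$ or $p=q^2$): The $q$-Pochhammer symbol is $(a;p)_N:=\prod_{j=0}^{N-1}(1-ap^j)$ for nonnegative integers $N$, so that $(-q;q)_{2k}=\prod_{j=1}^{2k}(1+q^j)$. The $q$-binomial coefficient is ${n \brack m}_p:=\dfrac{(p;p)_n}{(p;p)_m(p;p)_{n-m}}$ if $0\le m\le n$, and $0$ otherwise. The $q$-integer is $[n]_p:=\dfrac{1-p^n}{1-p}$ for every integer $n$ (including negative $n$); in particular $[k-m]_{q^2}=\dfrac{1-q^{2k-2m}}{1-q^2}$. Infinite sums are convergent series of complex numbers. *)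

(* Defs.v *)
From Stdlib Require Import Reals ZArith Arith.
From Coquelicot Require Import Coquelicot.

Open Scope C_scope.

Definition Cpow_Z (z : C) (n : Z) : C :=
  if (n <? 0)%Z then / (z ^ Z.to_nat (- n)) else z ^ Z.to_nat n.

Fixpoint qpoch (a p : C) (N : nat) : C :=
  match N with
  | O => 1
  | S j => qpoch a p j * (1 - a * p ^ j)
  end.

Definition qbinom (p : C) (n m : nat) : C :=
  if (m <=? n)%nat then qpoch p p n / (qpoch p p m * qpoch p p (n - m)) else 0.

Definition qint (p : C) (n : Z) : C := (1 - Cpow_Z p n) / (1 - p).

(* A series over { k | k <> m } is the series over all k whose m-th term is
   replaced by 0; this also discards the junk value of 1 / [0] at k = m. *)
Definition lhs_term (q : C) (m k : nat) : C :=
  if (k =? m)%nat then 0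
  else qbinom (q ^ 2) (2 * k) k
       * (q ^ k / (qpoch (- q) q (2 * k)
                   * qint (q ^ 2) (Z.of_nat k - Z.of_nat m))).

Definition rhs_term (q : C) (k : nat) : C :=
  (- (1)) ^ (k - 1) * q ^ k / qint q (Z.of_nat k).

(* Main.v *)
Require Import Defs.
From Stdlib Require Import Reals ZArith Arith Lia Lra.
From Coquelicot Require Import Coquelicot.

Open Scope C_scope.

(** Put [c_k = (q;q^2)_k / (q^2;q^2)_k] ([coef]) and
    [v(k,m) = q^(k+m) / (q^(2m) - q^(2k))], with [v(m,m) = 0] ([kern]).
    Since [(q^2;q^2)_(2k) = (q;q)_(2k) (-q;q)_(2k)], the quotient of the
    q-binomial coefficient by [(-q;q)_(2k)] is [c_k], and the theorem becomes
    [(1 - q) B_m = c_m T_m], where [B_m] is the sum over [k] of [c_k v(k,m)]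
    and [T_m] is the alternating tail on the right-hand side.

    The defect [D_m = (1 - q) B_m - c_m T_m] is shown to vanish in two steps.

    Algebra.  The first-order recurrence of [c] provides a telescoping relation
    between the summands of [B_m] and [B_(m+1)] ([coef_kern_telescope]).  Its
    only contributions come from [k = m] and [k = m + 1], where one of the two
    kernels is set to 0, and after normalization they are exactly the two terms
    by which [T_m] and [T_(m+1)] differ.  Hence [D] obeys the same recurrence as [c]
    ([defect_S]): the quotient [D_m / c_m] does not depend on [m].

    Analysis.  [D_m] tends to 0 as [m] grows ([defect_bound]) while [|c_m|]
    stays above a positive constant ([coef_bounds]), so the quotient is 0.  For
    [B_m], split [c_k = (c_k - c_m) + c_m].  The factor [c_k - c_m] is at most a
    multiple of [|q|^(2 min(k,m))], which together with the decay of [v] in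
    [|k - m|] bounds the first summand by a multiple of [|q|^(k+m)]
    ([coef_sub_kern]).
    In the second, [v] is antisymmetric and depends only on [k - m], so that
    the sum of [v(k,m)] over [k] reduces to a tail of a geometrically
    convergent series ([kern_series_shift]). *)

(** * The coefficients and the kernel *)

Definition coef (q : C) (k : nat) : C := qpoch q (q ^ 2) k / qpoch (q ^ 2) (q ^ 2) k.

(** The diagonal value is 0 because the inverse of 0 is 0 here; this encodes the
    omission of the index [k = m] and makes [kern] antisymmetric everywhere. *)
Definition kern (q : C) (k m : nat) : C := q ^ (k + m) / (q ^ (2 * m) - q ^ (2 * k)).

Lemma Cmod_lt_1_sub_nz (z : C) : (Cmod z < 1)%R -> 1 - z <> 0.
Proof.
  intros Hz H. assert (E : z = 1) by (replace z with (1 - (1 - z)) by ring; rewrite H; ring).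
  rewrite E, Cmod_1 in Hz. lra.
Qed.

Lemma Cmod_pow_S_lt_1 (q : C) (n : nat) : (Cmod q < 1)%R -> (Cmod (q ^ S n) < 1)%R.
Proof.
  intros Hq. rewrite Cmod_pow. pose proof (Cmod_ge_0 q).
  apply pow_lt_1_compat; [lra | lia].
Qed.

Lemma one_sub_pow_nz (q : C) (n : nat) : (Cmod q < 1)%R -> (0 < n)%nat -> 1 - q ^ n <> 0.
Proof.
  intros Hq Hn. destruct n as [|n]; [lia|].
  apply Cmod_lt_1_sub_nz, Cmod_pow_S_lt_1, Hq.
Qed.

Lemma one_add_pow_nz (q : C) (n : nat) : (Cmod q < 1)%R -> (0 < n)%nat -> 1 + q ^ n <> 0.
Proof.
  intros Hq Hn. destruct n as [|n]; [lia|].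
  replace (1 + q ^ S n) with (1 - - q ^ S n) by ring.
  apply Cmod_lt_1_sub_nz. rewrite Cmod_opp. apply Cmod_pow_S_lt_1, Hq.
Qed.

Lemma qpoch_nz (q : C) (k : nat) : (Cmod q < 1)%R -> qpoch q q k <> 0.
Proof.
  intros Hq. induction k as [|k IH]; simpl.
  - apply C1_nz.
  - apply Cmult_neq_0; [exact IH|]. apply (one_sub_pow_nz q (S k) Hq). lia.
Qed.

Lemma qpoch_opp_nz (q : C) (k : nat) : (Cmod q < 1)%R -> qpoch (- q) q k <> 0.
Proof.
  intros Hq. induction k as [|k IH]; simpl.
  - apply C1_nz.
  - apply Cmult_neq_0; [exact IH|].
    replace (1 - - q * q ^ k) with (1 + q ^ S k) by (rewrite Cpow_S; ring).
    apply one_add_pow_nz; [exact Hq | lia].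
Qed.

Lemma Cmod_sqr_lt_1 (q : C) : (Cmod q < 1)%R -> (Cmod (q ^ 2) < 1)%R.
Proof. apply Cmod_pow_S_lt_1. Qed.

Lemma qpoch_sqr (q : C) (k : nat) :
  qpoch (q ^ 2) (q ^ 2) k = qpoch q q k * qpoch (- q) q k.
Proof.
  induction k as [|k IH]; cbn [qpoch]; [ring|].
  rewrite IH, <- Cpow_mult_r. replace (2 * k)%nat with (k + k)%nat by lia. rewrite Cpow_add_r. ring.
Qed.

Lemma qpoch_double (q : C) (k : nat) :
  qpoch q q (2 * k) = qpoch q (q ^ 2) k * qpoch (q ^ 2) (q ^ 2) k.
Proof.
  induction k as [|k IH]; [simpl; ring|].
  replace (2 * S k)%nat with (S (S (2 * k))) by lia.
  cbn [qpoch]. rewrite IH, <- Cpow_mult_r, (Cpow_S q (2 * k)). ring.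
Qed.

Lemma qbinom_coef (q : C) (k : nat) : (Cmod q < 1)%R ->
  qbinom (q ^ 2) (2 * k) k / qpoch (- q) q (2 * k) = coef q k.
Proof.
  intros Hq. unfold qbinom, coef.
  replace (k <=? 2 * k)%nat with true by (symmetry; apply Nat.leb_le; lia).
  replace (2 * k - k)%nat with k by lia.
  rewrite (qpoch_sqr q (2 * k)), (qpoch_double q k).
  pose proof (qpoch_nz (q ^ 2) k (Cmod_sqr_lt_1 q Hq)).
  pose proof (qpoch_opp_nz q (2 * k) Hq).
  field. auto.
Qed.

Lemma coef_0 (q : C) : coef q 0 = 1.
Proof. unfold coef; simpl; field. Qed.

Lemma coef_S (q : C) (k : nat) : (Cmod q < 1)%R ->
  coef q (S k) * (1 - q ^ (2 * k + 2)) = coef q k * (1 - q ^ (2 * k + 1)).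
Proof.
  intros Hq. unfold coef.
  pose proof (qpoch_nz (q ^ 2) k (Cmod_sqr_lt_1 q Hq)) as H.
  pose proof (qpoch_nz (q ^ 2) (S k) (Cmod_sqr_lt_1 q Hq)) as H'.
  cbn [qpoch] in *. 
  rewrite <- Cpow_mult_r in *.
  rewrite !Cpow_add_r in *. rewrite Cpow_1_r. field.
  split; [exact H|]. intro E. apply H'.
  replace (1 - q ^ 2 * q ^ (2 * k)) with (RtoC 0) by (rewrite <- E; ring). ring.
Qed.

Lemma pow_even_sub_nz (q : C) (k m : nat) : (0 < Cmod q < 1)%R -> k <> m ->
  q ^ (2 * m) - q ^ (2 * k) <> 0.
Proof.
  intros Hq. assert (Hq0 : q <> 0) by (apply Cmod_gt_0; lra).
  assert (W : forall a i, q ^ (2 * a) - q ^ (2 * (a + S i)) <> 0).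
  { intros a i. replace (2 * (a + S i))%nat with (2 * a + 2 * S i)%nat by lia.
    rewrite Cpow_add_r.
    replace (_ - _) with (q ^ (2 * a) * (1 - q ^ (2 * S i))) by ring.
    apply Cmult_neq_0; [apply Cpow_nz, Hq0 | apply one_sub_pow_nz; [lra | lia]]. }
  intros Hkm. destruct (Nat.lt_total k m) as [H|[H|H]]; [|lia|].
  - replace m with (k + S (m - k - 1))%nat by lia. intro E.
    apply (W k (m - k - 1)%nat).
    replace (_ - _) with (- (q ^ (2 * (k + S (m - k - 1))) - q ^ (2 * k))) by ring.
    rewrite E. ring.
  - replace k with (m + S (k - m - 1))%nat by lia. apply W.
Qed.

Lemma kern_diag (q : C) (k : nat) : kern q k k = 0.
Proof.
  unfold kern, Cdiv. replace (_ - _) with (RtoC 0) by ring.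
  replace (/ 0) with (RtoC 0); [ring|].
  unfold Cinv, RtoC; simpl; f_equal; unfold Rdiv; ring.
Qed.

(** The form of the kernel free of denominators: the case distinction on
    [k = m] appears once, and later identities become polynomial. *)
Lemma kern_mul (q : C) (k m : nat) : (0 < Cmod q < 1)%R ->
  (q ^ (2 * m) - q ^ (2 * k)) * kern q k m
  = q ^ (k + m) - (if (k =? m)%nat then q ^ (k + m) else 0).
Proof.
  intros Hq. destruct (Nat.eqb_spec k m) as [->|H]; [ring|].
  unfold kern. field. apply pow_even_sub_nz; assumption.
Qed.

Lemma kern_shift (q : C) (k m : nat) : (0 < Cmod q < 1)%R ->
  kern q (S k) (S m) = kern q k m.
Proof.
  intros Hq. assert (Hq0 : q <> 0) by (apply Cmod_gt_0; lra).
  destruct (Nat.eq_dec k m) as [->|H]; [now rewrite !kern_diag|].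
  pose proof (pow_even_sub_nz q k m Hq H) as N.
  pose proof (pow_even_sub_nz q (S k) (S m) Hq ltac:(lia)) as N'.
  unfold kern. revert N'. 
  replace (2 * S m)%nat with (2 + 2 * m)%nat by lia.
  replace (2 * S k)%nat with (2 + 2 * k)%nat by lia.
  replace (S k + S m)%nat with (2 + (k + m))%nat by lia.
  rewrite (Cpow_add_r q 2 (k + m)), (Cpow_add_r q 2 (2 * m)), (Cpow_add_r q 2 (2 * k)).
  intros N'. field. split; [exact N|].
  intro E; apply N'; rewrite <- E; ring.
Qed.

Lemma kern_anti (q : C) (k m : nat) : (0 < Cmod q < 1)%R ->
  kern q k m = - kern q m k.
Proof.
  intros Hq. destruct (Nat.eq_dec k m) as [->|H]; [rewrite kern_diag; ring|].
  pose proof (pow_even_sub_nz q k m Hq H) as N.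
  pose proof (pow_even_sub_nz q m k Hq ltac:(lia)) as N'.
  unfold kern. rewrite (Nat.add_comm m k). field. auto.
Qed.

(** The telescoping relation for the summands [c_k v(k,m)].  It goes back to the
    functional equation [(1 - z) F(z) = (1 - q z) F(q^2 z)] of the partial
    fraction expansion [F(z)] that sums [c_k q^k / (1 - z q^(2k))] over [k]; the
    two indicators come from the poles met at [z = q^(-2m-2)]. *)
Lemma coef_kern_telescope (q : C) (m k : nat) : (0 < Cmod q < 1)%R ->
  coef q k * kern q k (S m) * (1 - q ^ (2 * m + 2))
  = coef q k * kern q k m * (1 - q ^ (2 * m + 1))
    + (coef q k * (1 - q ^ (2 * k)) * kern q k (S m)
       - coef q (S k) * (1 - q ^ (2 * S k)) * kern q (S k) (S m))
    + ((if (k =? S m)%nat then coef q (S m) * q ^ (2 * m + 2) else 0)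
       - (if (k =? m)%nat then coef q m * q ^ (2 * m + 1) else 0)).
Proof.
  intros Hq.
  rewrite kern_shift by exact Hq.
  replace (2 * S k)%nat with (2 * k + 2)%nat by lia.
  rewrite coef_S by lra.
  (* Both indicators are read off from [kern_mul], which leaves a polynomial
     identity in [c_k], [q^k], [q^m] and the two kernel values. *)
  pose proof (kern_mul q k m Hq) as E1.
  pose proof (kern_mul q k (S m) Hq) as E2.
  replace (2 * S m)%nat with (2 * m + 2)%nat in E2 by lia.
  replace (if (k =? S m)%nat then coef q (S m) * q ^ (2 * m + 2) else 0)
     with (coef q k * (if (k =? S m)%nat then q ^ (k + S m) else 0)).
  2:{ destruct (Nat.eqb_spec k (S m)) as [->|]; [|ring].
      replace (S m + S m)%nat with (2 * m + 2)%nat by lia. ring. }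
  replace (if (k =? m)%nat then coef q m * q ^ (2 * m + 1) else 0)
     with (coef q k * (q * (if (k =? m)%nat then q ^ (k + m) else 0))).
  2:{ destruct (Nat.eqb_spec k m) as [->|]; [|ring].
      replace (m + m)%nat with (2 * m)%nat by lia. rewrite Cpow_add_r. ring. }
  set (d1 := if (k =? m)%nat then _ else _) in *.
  set (d2 := if (k =? S m)%nat then _ else _) in *.
  replace d1 with (q ^ (k + m) - (q ^ (2 * m) - q ^ (2 * k)) * kern q k m) by (rewrite E1; ring).
  replace d2 with (q ^ (k + S m) - (q ^ (2 * m + 2) - q ^ (2 * k)) * kern q k (S m)) by (rewrite E2; ring).
  replace (k + S m)%nat with (k + m + 1)%nat by lia.
  rewrite !Cpow_add_r, Cpow_1_r. ring.
Qed.

(** * Complex series *)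

Lemma sum_Sn_C (a : nat -> C) (n : nat) : sum_n a (S n) = sum_n a n + a (S n).
Proof. apply (sum_Sn a n). Qed.

Lemma is_series_cons (a : nat -> C) (l : C) :
  is_series (fun k => a (S k)) l -> is_series a (a O + l).
Proof.
  intros H. apply is_series_decr_1.
  assert (E : plus (a O + l) (opp (a O)) = l :> C)
    by (unfold plus, opp; simpl; ring).
  rewrite <- E in H. exact H.
Qed.

Lemma is_series_uncons (a : nat -> C) (l : C) :
  is_series a l -> is_series (fun k => a (S k)) (l - a O).
Proof.
  intros H. apply is_series_incr_1.
  assert (E : plus (l - a O) (a O) = l :> C) by (unfold plus; simpl; ring).
  rewrite <- E in H. exact H.
Qed.

Lemma is_series_Cmod_le (a : nat -> C) (b : nat -> R) (l : C) (s : R) :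
  (forall n, Cmod (a n) <= b n)%R -> is_series a l -> is_series b s -> (Cmod l <= s)%R.
Proof.
  intros H Ha Hb.
  assert (Hp : forall n, (Cmod (sum_n a n) <= sum_n b n)%R).
  { induction n as [|n IH]; [rewrite !sum_O; apply H|].
    rewrite !sum_Sn. eapply Rle_trans; [apply Cmod_triangle|].
    apply Rplus_le_compat; [exact IH | apply H]. }
  apply (is_lim_seq_le (fun n => Cmod (sum_n a n)) (sum_n b) (Cmod l) s Hp).
  - apply (filterlim_comp _ _ _ (sum_n a) Cmod eventually (locally l)).
    + exact Ha.
    + apply (filterlim_norm (V := C_NormedModule) l).
  - exact Hb.
Qed.

Lemma ex_series_Cmod_le (a : nat -> C) (b : nat -> R) (s : R) :
  (forall n, Cmod (a n) <= b n)%R -> is_series b s -> exists l : C, is_series a l.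
Proof.
  intros H Hb.
  apply (ex_series_le (V := C_CompleteNormedModule) a b H). exists s. exact Hb.
Qed.

Lemma is_series_indicator (p : nat) (a : C) :
  is_series (fun k => if (k =? p)%nat then a else RtoC 0) a.
Proof.
  assert (S : forall n, sum_n (fun k => if (k =? p)%nat then a else RtoC 0) n
                        = (if (p <=? n)%nat then a else 0) :> C).
  { induction n as [|n IH].
    - rewrite sum_O. destruct p; reflexivity.
    - rewrite sum_Sn_C, IH.
      destruct (Nat.eqb_spec (S n) p), (Nat.leb_spec p n), (Nat.leb_spec p (S n));
        try lia; ring. }
  apply filterlim_ext_loc with (f := fun _ => a).
  - exists p. intros n Hn. rewrite S.
    now replace (p <=? n)%nat with true by (symmetry; apply Nat.leb_le; exact Hn).
  - apply filterlim_const.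
Qed.

Lemma is_series_telescope (g : nat -> C) (b : nat -> R) :
  (forall n, Cmod (g n) <= b n)%R -> is_lim_seq b 0 ->
  is_series (fun k => g k - g (S k)) (g O).
Proof.
  intros Hg Hb.
  assert (S : forall n, g O - g (S n) = sum_n (fun k => g k - g (S k)) n).
  { induction n as [|n IH]; [now rewrite sum_O|].
    rewrite sum_Sn_C, <- IH. ring. }
  apply filterlim_ext with (1 := S).
  apply (filterlim_ext (fun n => plus (g O) (opp (g (Datatypes.S n))))); [reflexivity|].
  replace (g O) with (plus (g O) (opp (RtoC 0))) at 1
    by (unfold plus, opp; simpl; ring).
  eapply (filterlim_comp_2 (fun _ => g O) (fun n => opp (g (Datatypes.S n))) plus).
  - apply filterlim_const.
  - eapply (filterlim_comp _ _ _ (fun n => g (Datatypes.S n)) opp); [|apply (filterlim_opp (V := C_NormedModule))].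
    apply (filterlim_norm_zero (V := C_NormedModule) (F := eventually)).
    apply (is_lim_seq_le_le (fun _ => 0%R) _ (fun n => b (Datatypes.S n)) 0).
    + intros n. split; [apply Cmod_ge_0 | apply Hg].
    + apply is_lim_seq_const.
    + apply (is_lim_seq_incr_1 b 0), Hb.
  - apply (filterlim_plus (V := C_NormedModule)).
Qed.

Lemma is_series_pow (r K : R) : (0 <= r < 1)%R ->
  is_series (fun n => K * r ^ n)%R (K * / (1 - r))%R.
Proof.
  intros Hr. apply (is_series_scal_l (V := R_NormedModule) K).
  apply is_series_geom. rewrite Rabs_pos_eq; lra.
Qed.

(** * Bounds on the coefficients *)

(** The partial products of [(r;r)_n], which control [|c_k|] from both sides. *)
Fixpoint euler_prod (r : R) (n : nat) : R :=
  match n with O => 1%R | S j => (euler_prod r j * (1 - r ^ S j))%R end.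

Lemma pow_le_self (r : R) (n : nat) : (0 <= r < 1)%R -> (0 <= r ^ S n <= r)%R.
Proof.
  intros Hr. split; [apply pow_le; lra|].
  induction n as [|n IH]; [simpl; lra|].
  rewrite <- tech_pow_Rmult. pose proof (pow_le r (S n) ltac:(lra)). nra.
Qed.

(** From [1/(1 - x) = 1 + x/(1 - x)] and [1 + t <= exp t]; the denominator is
    weakened to [1 - r] so that the exponents add up over a product. *)
Lemma exp_le_one_sub (r x : R) : (0 <= x <= r)%R -> (r < 1)%R ->
  (exp (- (x / (1 - r))) <= 1 - x)%R.
Proof.
  intros Hx Hr. rewrite exp_Ropp.
  replace (1 - x)%R with (/ / (1 - x))%R by (rewrite Rinv_inv; reflexivity).
  apply Rinv_le_contravar; [apply Rinv_0_lt_compat; lra|].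
  apply Rle_trans with (1 + x / (1 - r))%R; [|apply exp_ineq1_le].
  apply Rle_trans with (1 + x / (1 - x))%R; [right; field; lra|].
  apply Rplus_le_compat_l. apply Rmult_le_compat_l; [lra|].
  apply Rinv_le_contravar; lra.
Qed.

Lemma euler_prod_lower (r : R) (n : nat) : (0 <= r < 1)%R ->
  (exp (- (r / (1 - r) ^ 2)) <= euler_prod r n)%R.
Proof.
  intros Hr.
  (* [r - r^(n+1)] is [1 - r] times the sum of [r^j] for [1 <= j <= n], so this
     exponent is additive along the product. *)
  apply Rle_trans with (exp (- ((r - r ^ S n) / (1 - r) ^ 2))).
  - destruct (Req_dec (r ^ S n) 0) as [E|E].
    + rewrite E. right. f_equal. f_equal. f_equal. ring.
    + left. apply exp_increasing. apply Ropp_lt_contravar.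
      apply Rmult_lt_compat_r; [apply Rinv_0_lt_compat, pow_lt; lra|].
      pose proof (pow_le_self r n Hr). lra.
  - induction n as [|n IH].
    + simpl. replace (- _)%R with 0%R by (field; lra). rewrite exp_0. lra.
    + replace (- ((r - r ^ S (S n)) / (1 - r) ^ 2))%R
        with (- ((r - r ^ S n) / (1 - r) ^ 2) + - (r ^ S n / (1 - r)))%R
        by (simpl; field; lra).
      rewrite exp_plus. simpl euler_prod.
      apply Rmult_le_compat; try (left; apply exp_pos); [exact IH|].
      apply exp_le_one_sub; [apply pow_le_self; exact Hr | lra].
Qed.

Lemma Cmod_1_sub (z : C) : (1 - Cmod z <= Cmod (1 - z) <= 1 + Cmod z)%R.
Proof.
  split.
  - pose proof (Cmod_triangle (1 - z) z) as H.
    replace (1 - z + z) with (RtoC 1) in H by ring. rewrite Cmod_1 in H. lra.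
  - pose proof (Cmod_triangle 1 (- z)) as H. rewrite Cmod_1, Cmod_opp in H. exact H.
Qed.

Lemma Cmod_1_sub_pow (q : C) (n : nat) : (Cmod q < 1)%R ->
  (1 - Cmod q <= Cmod (1 - q ^ S n))%R.
Proof.
  intros Hq. pose proof (Cmod_ge_0 q).
  pose proof (Cmod_1_sub (q ^ S n)) as [H1 _]. rewrite Cmod_pow in H1.
  pose proof (pow_le_self (Cmod q) n ltac:(lra)). lra.
Qed.

(** Each factor of [c_k] is [(1 - q^(2j+1)) / (1 - q^(2j+2))], and
    [1 + x <= 1/(1 - x)] lets both the upper and the lower bound be expressed
    through the same product of factors [1 - |q|^j]. *)
Lemma coef_euler (q : C) (k : nat) : (Cmod q < 1)%R ->
  (0 < euler_prod (Cmod q) (2 * k) <= Cmod (coef q k)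
   /\ Cmod (coef q k) * euler_prod (Cmod q) (2 * k) <= 1)%R.
Proof.
  intros Hq. pose proof (Cmod_ge_0 q) as Hq0.
  induction k as [|k IH].
  { rewrite coef_0, Cmod_1. simpl. lra. }
  pose proof (coef_S q k Hq) as E. apply (f_equal Cmod) in E. rewrite !Cmod_mult in E.
  replace (2 * S k)%nat with (S (S (2 * k))) by lia. cbn [euler_prod].
  pose proof (Cmod_1_sub (q ^ (2 * k + 1))) as Hx.
  pose proof (Cmod_1_sub (q ^ (2 * k + 2))) as Hy.
  rewrite Cmod_pow in Hx, Hy.
  replace (2 * k + 1)%nat with (S (2 * k)) in * by lia.
  replace (2 * k + 2)%nat with (S (S (2 * k))) in * by lia.
  pose proof (pow_le_self (Cmod q) (2 * k) ltac:(lra)) as Bx.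
  pose proof (pow_le_self (Cmod q) (S (2 * k)) ltac:(lra)) as By.
  pose proof (Cmod_ge_0 (coef q k)). pose proof (Cmod_ge_0 (coef q (S k))).
  set (x := (Cmod q ^ S (2 * k))%R) in *. set (y := (Cmod q ^ S (S (2 * k)))%R) in *.
  set (P := euler_prod (Cmod q) (2 * k)) in *.
  set (c := Cmod (coef q k)) in *. set (c' := Cmod (coef q (S k))) in *.
  set (u := Cmod (1 - q ^ S (2 * k))) in *. set (w := Cmod (1 - q ^ S (S (2 * k)))) in *.
  clearbody x y P c c' u w. destruct IH as [[P0 IH1] IH2].
  assert (HP : (0 < P * (1 - x))%R) by (apply Rmult_lt_0_compat; lra).
  split; [split|].
  - apply Rmult_lt_0_compat; lra.
  - apply Rle_trans with (c * u * (1 - y))%R.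
    + apply Rmult_le_compat_r; [lra|]. apply Rmult_le_compat; lra.
    + rewrite <- E. apply Rle_trans with (c' * ((1 + y) * (1 - y)))%R.
      * rewrite Rmult_assoc. apply Rmult_le_compat_l; [lra|].
        apply Rmult_le_compat_r; lra.
      * rewrite <- (Rmult_1_r c') at 2. apply Rmult_le_compat_l; [lra|]. nra.
  - apply Rle_trans with (c' * w * (P * (1 - x)))%R.
    + replace (c' * (P * (1 - x) * (1 - y)))%R with (c' * (1 - y) * (P * (1 - x)))%R by ring.
      apply Rmult_le_compat_r; [lra|]. apply Rmult_le_compat_l; lra.
    + rewrite E. apply Rle_trans with (c * P * ((1 + x) * (1 - x)))%R.
      * replace (c * P * ((1 + x) * (1 - x)))%R with (c * (1 + x) * (P * (1 - x)))%R by ring.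
        apply Rmult_le_compat_r; [lra|]. apply Rmult_le_compat_l; lra.
      * assert (0 <= c * P)%R by (apply Rmult_le_pos; lra). nra.
Qed.

Lemma coef_bounds (q : C) : (Cmod q < 1)%R ->
  exists d, (0 < d)%R /\ forall k, (d <= Cmod (coef q k) <= / d)%R.
Proof.
  intros Hq. pose proof (Cmod_ge_0 q) as Hq0.
  exists (exp (- (Cmod q / (1 - Cmod q) ^ 2))). split; [apply exp_pos|].
  intros k. pose proof (euler_prod_lower (Cmod q) (2 * k) ltac:(lra)) as L.
  pose proof (exp_pos (- (Cmod q / (1 - Cmod q) ^ 2))) as P.
  set (d := exp _) in *. destruct (coef_euler q k Hq) as [H1 H2]. split; [lra|].
  apply Rmult_le_reg_r with d; [exact P|]. rewrite Rinv_l by lra.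
  pose proof (Cmod_ge_0 (coef q k)). nra.
Qed.

(** [c_(k+1) - c_k] carries the factor [q^(2k+1) (q - 1)] by the recurrence. *)
Lemma coef_S_sub (q : C) (k : nat) (M : R) : (Cmod q < 1)%R ->
  (Cmod (coef q k) <= M)%R ->
  (Cmod (coef q (S k) - coef q k) <= 2 * M / (1 - Cmod q) * Cmod q ^ (2 * k))%R.
Proof.
  intros Hq HM. pose proof (Cmod_ge_0 q) as Hq0.
  assert (E : (coef q (S k) - coef q k) * (1 - q ^ (2 * k + 2))
              = coef q k * (q ^ (2 * k) * (q * (q - 1)))).
  { replace ((coef q (S k) - coef q k) * (1 - q ^ (2 * k + 2)))
      with (coef q (S k) * (1 - q ^ (2 * k + 2)) - coef q k * (1 - q ^ (2 * k + 2))) by ring.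
    rewrite coef_S by exact Hq. rewrite !Cpow_add_r. ring. }
  apply (f_equal Cmod) in E. rewrite !Cmod_mult, Cmod_pow in E.
  pose proof (Cmod_1_sub_pow q (2 * k + 1) Hq) as L.
  replace (S (2 * k + 1)) with (2 * k + 2)%nat in L by lia.
  assert (U : (Cmod (q - 1) <= 2)%R).
  { pose proof (Cmod_1_sub q). replace (q - 1) with (- (1 - q)) by ring.
    rewrite Cmod_opp. lra. }
  pose proof (Cmod_ge_0 (coef q (S k) - coef q k)) as D0.
  pose proof (Cmod_ge_0 (coef q k)). pose proof (Cmod_ge_0 (q - 1)).
  pose proof (pow_le (Cmod q) (2 * k) Hq0) as X.
  apply Rmult_le_reg_r with (1 - Cmod q)%R; [lra|].
  apply Rle_trans with (Cmod (coef q (S k) - coef q k) * Cmod (1 - q ^ (2 * k + 2)))%R.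
  { apply Rmult_le_compat_l; assumption. }
  rewrite E.
  replace (2 * M / (1 - Cmod q) * Cmod q ^ (2 * k) * (1 - Cmod q))%R
    with (M * (Cmod q ^ (2 * k) * 2))%R by (field; lra).
  apply Rmult_le_compat; try assumption.
  - apply Rmult_le_pos; [assumption|]. apply Rmult_le_pos; assumption.
  - apply Rmult_le_compat_l; [assumption|]. nra.
Qed.

(** The increments beyond [m] form a geometric series starting at
    [|q|^(2m)]. *)
Lemma coef_sub (q : C) (M : R) (m i : nat) : (Cmod q < 1)%R ->
  (forall k, Cmod (coef q k) <= M)%R ->
  (Cmod (coef q (m + i) - coef q m)
   <= 2 * M / (1 - Cmod q) ^ 2 * Cmod q ^ (2 * m))%R.
Proof.
  intros Hq HM. pose proof (Cmod_ge_0 q) as Hq0.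
  assert (M0 : (0 <= M)%R) by (eapply Rle_trans; [apply Cmod_ge_0 | apply (HM O)]).
  pose proof (pow_le (Cmod q) (2 * m) Hq0) as X.
  assert (B : (0 <= 2 * M / (1 - Cmod q) ^ 2 * Cmod q ^ (2 * m))%R).
  { apply Rmult_le_pos; [|exact X]. apply Rmult_le_pos; [lra|].
    left; apply Rinv_0_lt_compat, pow_lt; lra. }
  (* The factor [1 - |q|^i] keeps track of the partial geometric sum. *)
  assert (H : (Cmod (coef q (m + i) - coef q m)
   <= 2 * M / (1 - Cmod q) ^ 2 * Cmod q ^ (2 * m) * (1 - Cmod q ^ i))%R).
  { induction i as [|i IH].
    - rewrite Nat.add_0_r. replace (_ - _) with (RtoC 0) by ring. rewrite Cmod_0. simpl. lra.
    - rewrite Nat.add_succ_r.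
      replace (coef q (S (m + i)) - coef q m)
        with ((coef q (S (m + i)) - coef q (m + i)) + (coef q (m + i) - coef q m)) by ring.
      eapply Rle_trans; [apply Cmod_triangle|].
      pose proof (coef_S_sub q (m + i) M Hq (HM _)) as S1.
      replace (2 * (m + i))%nat with (2 * m + i + i)%nat in S1 by lia.
      rewrite !pow_add in S1.
      pose proof (pow_le (Cmod q) i Hq0) as Y.
      assert (Y1 : (Cmod q ^ i <= 1)%R).
      { rewrite <- (pow1 i). apply pow_incr. lra. }
      replace (2 * M / (1 - Cmod q) ^ 2 * Cmod q ^ (2 * m) * (1 - Cmod q ^ S i))%R
        with (2 * M / (1 - Cmod q) * (Cmod q ^ (2 * m) * Cmod q ^ i * 1)
              + 2 * M / (1 - Cmod q) ^ 2 * Cmod q ^ (2 * m) * (1 - Cmod q ^ i))%R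
        by (simpl; field; lra).
      apply Rplus_le_compat; [|exact IH].
      eapply Rle_trans; [exact S1|].
      apply Rmult_le_compat_l.
      + apply Rmult_le_pos; [lra|]. left; apply Rinv_0_lt_compat; lra.
      + apply Rmult_le_compat_l; [apply Rmult_le_pos; assumption | exact Y1]. }
  eapply Rle_trans; [exact H|].
  pose proof (pow_le (Cmod q) i Hq0).
  set (b := (2 * M / (1 - Cmod q) ^ 2 * Cmod q ^ (2 * m))%R) in *. nra.
Qed.

(** * Bounds on the kernel *)

Lemma kern_shift_iter (q : C) (m i : nat) : (0 < Cmod q < 1)%R ->
  kern q (m + i) m = kern q i 0.
Proof.
  intros Hq. induction m as [|m IH]; [reflexivity|].
  rewrite <- IH. apply kern_shift, Hq.
Qed.

Lemma kern_0_bound (q : C) (i : nat) : (0 < Cmod q < 1)%R ->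
  (Cmod (kern q i 0) <= / (1 - Cmod q) * Cmod q ^ i)%R.
Proof.
  intros Hq.
  assert (V : (0 <= / (1 - Cmod q))%R) by (left; apply Rinv_0_lt_compat; lra).
  destruct i as [|i].
  { rewrite kern_diag, Cmod_0. apply Rmult_le_pos; [exact V|]. apply pow_le; lra. }
  unfold kern.
  replace (q ^ (2 * 0) - q ^ (2 * S i)) with (1 - q ^ S (2 * i + 1)).
  2:{ simpl (2 * 0)%nat. replace (2 * S i)%nat with (S (2 * i + 1)) by lia. reflexivity. }
  rewrite Nat.add_0_r, Cmod_div, Cmod_pow by (apply one_sub_pow_nz; [lra | lia]).
  rewrite (Rmult_comm (/ _)). apply Rmult_le_compat_l; [apply pow_le; lra|].
  apply Rinv_le_contravar; [lra|]. apply Cmod_1_sub_pow; lra.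
Qed.

Lemma kern_bound (q : C) (k m : nat) : (0 < Cmod q < 1)%R ->
  (Cmod (kern q k m) <= / (1 - Cmod q) * / Cmod q ^ m * Cmod q ^ k)%R.
Proof.
  intros Hq.
  assert (V : (0 < / (1 - Cmod q))%R) by (apply Rinv_0_lt_compat; lra).
  pose proof (pow_lt (Cmod q) m ltac:(lra)) as Pm.
  pose proof (pow_lt (Cmod q) k ltac:(lra)) as Pk.
  destruct (Nat.le_ge_cases m k) as [H|H].
  - replace (kern q k m) with (kern q (m + (k - m)) m) by (f_equal; lia).
    rewrite kern_shift_iter by exact Hq.
    eapply Rle_trans; [apply kern_0_bound, Hq|].
    replace k with (m + (k - m))%nat at 2 by lia. rewrite pow_add. right. field. lra.
  - rewrite kern_anti, Cmod_opp by exact Hq.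
    replace (kern q m k) with (kern q (k + (m - k)) k) by (f_equal; lia).
    rewrite kern_shift_iter by exact Hq.
    eapply Rle_trans; [apply kern_0_bound, Hq|].
    rewrite Rmult_assoc. apply Rmult_le_compat_l; [lra|].
    apply Rmult_le_reg_l with (Cmod q ^ m)%R; [exact Pm|].
    rewrite <- Rmult_assoc, Rinv_r, Rmult_1_l by lra.
    replace m with (k + (m - k))%nat at 1 by lia. rewrite pow_add.
    pose proof (pow_lt (Cmod q) (m - k) ltac:(lra)).
    assert (Cmod q ^ (m - k) <= 1)%R by (rewrite <- (pow1 (m - k)); apply pow_incr; lra).
    rewrite Rmult_assoc. rewrite <- (Rmult_1_r (Cmod q ^ k)) at 2.
    apply Rmult_le_compat_l; [lra|]. nra.
Qed.

(** * Convergence and decay of the sums B_m *)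

(** The key estimate: for [k >= m] the two factors are of size [|q|^(2m)] and
    [|q|^(k-m)]; the product being symmetric in [k] and [m], the case [k <= m]
    follows. *)
Lemma coef_sub_kern (q : C) (M : R) (k m : nat) : (0 < Cmod q < 1)%R ->
  (forall k, Cmod (coef q k) <= M)%R ->
  (Cmod ((coef q k - coef q m) * kern q k m)
   <= 2 * M / (1 - Cmod q) ^ 3 * Cmod q ^ (k + m))%R.
Proof.
  intros Hq HM.
  assert (W : forall i n, (Cmod ((coef q (n + i) - coef q n) * kern q (n + i) n)
                 <= 2 * M / (1 - Cmod q) ^ 3 * Cmod q ^ (n + i + n))%R).
  { intros i n. rewrite Cmod_mult, kern_shift_iter by exact Hq.
    replace (2 * M / (1 - Cmod q) ^ 3 * Cmod q ^ (n + i + n))%R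
      with (2 * M / (1 - Cmod q) ^ 2 * Cmod q ^ (2 * n) * (/ (1 - Cmod q) * Cmod q ^ i))%R.
    - apply Rmult_le_compat; try apply Cmod_ge_0.
      + apply coef_sub; [lra | exact HM].
      + apply kern_0_bound, Hq.
    - replace (n + i + n)%nat with (2 * n + i)%nat by lia. rewrite pow_add. field. lra. }
  destruct (Nat.le_ge_cases m k) as [H|H].
  - replace k with (m + (k - m))%nat by lia. apply W.
  - replace ((coef q k - coef q m) * kern q k m) with ((coef q m - coef q k) * kern q m k)
      by (rewrite (kern_anti q k m Hq); ring).
    rewrite Nat.add_comm. replace m with (k + (m - k))%nat by lia. apply W.
Qed.

(** In the sum over [k] of [v(k,m)], the terms [k = m - i] and [k = m + i] cancel
    for [1 <= i <= m]; the terms [k > 2m] remain and are [v(j,0)] with [j > m].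
    The induction on [m] removes one term at a time. *)
Lemma kern_series_shift (q : C) (m : nat) : (0 < Cmod q < 1)%R -> forall l : C,
  is_series (fun j => kern q (m + 1 + j) 0) l -> is_series (fun k => kern q k m) l.
Proof.
  intros Hq. induction m as [|m IH]; intros l Hl.
  - replace l with (kern q 0 0 + l) by (rewrite kern_diag; ring).
    apply (is_series_cons (fun k => kern q k 0)). exact Hl.
  - replace l with (kern q 0 (S m) + (kern q (m + 1 + 0) 0 + l)).
    2:{ rewrite (kern_anti q 0), Nat.add_0_r, Nat.add_1_r by exact Hq. ring. }
    apply (is_series_cons (fun k => kern q k (S m))).
    apply (is_series_ext (fun k => kern q k m)); [intros n; symmetry; apply kern_shift, Hq|].
    apply IH, (is_series_cons (fun j => kern q (m + 1 + j) 0)).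
    eapply is_series_ext; [|exact Hl]. intros n. simpl. f_equal. lia.
Qed.

(** This is where the decay in [m] comes from: the remaining tail starts at
    [|q|^(m+1)]. *)
Lemma kern_series (q : C) (m : nat) : (0 < Cmod q < 1)%R ->
  exists A : C, is_series (fun k => kern q k m) A
    /\ (Cmod A <= / (1 - Cmod q) ^ 2 * Cmod q ^ m)%R.
Proof.
  intros Hq.
  assert (B : forall j, (Cmod (kern q (m + 1 + j) 0)
                <= / (1 - Cmod q) * Cmod q ^ m * Cmod q ^ j)%R).
  { intros j. eapply Rle_trans; [apply kern_0_bound, Hq|].
    rewrite Rmult_assoc. apply Rmult_le_compat_l; [left; apply Rinv_0_lt_compat; lra|].
    rewrite !pow_add, pow_1. apply Rmult_le_compat_r; [apply pow_le; lra|].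
    pose proof (pow_le (Cmod q) m ltac:(lra)). nra. }
  pose proof (is_series_pow (Cmod q) (/ (1 - Cmod q) * Cmod q ^ m) ltac:(lra)) as G.
  destruct (ex_series_Cmod_le _ _ _ B G) as [A HA].
  exists A. split; [apply kern_series_shift; assumption|].
  eapply Rle_trans; [exact (is_series_Cmod_le _ _ _ _ B HA G)|].
  right. field. lra.
Qed.

(** Split [c_k v(k,m)] as [(c_k - c_m) v(k,m) + c_m v(k,m)]. *)
Lemma coef_kern_series (q : C) : (0 < Cmod q < 1)%R ->
  exists K, forall m, exists B : C, is_series (fun k => coef q k * kern q k m) B
    /\ (Cmod B <= K * Cmod q ^ m)%R.
Proof.
  intros Hq. destruct (coef_bounds q ltac:(lra)) as [d [d0 Hd]].
  exists (2 * / d / (1 - Cmod q) ^ 4 + / d / (1 - Cmod q) ^ 2)%R. intros m.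
  destruct (kern_series q m Hq) as [A [HA BA]].
  assert (B : forall k, (Cmod ((coef q k - coef q m) * kern q k m)
     <= 2 * / d / (1 - Cmod q) ^ 3 * Cmod q ^ m * Cmod q ^ k)%R).
  { intros k. eapply Rle_trans; [apply (coef_sub_kern q (/ d) k m Hq); intros; apply Hd|].
    rewrite pow_add. right; ring. }
  pose proof (is_series_pow (Cmod q) (2 * / d / (1 - Cmod q) ^ 3 * Cmod q ^ m) ltac:(lra)) as G.
  destruct (ex_series_Cmod_le _ _ _ B G) as [E HE].
  pose proof (is_series_Cmod_le _ _ _ _ B HE G) as BE.
  exists (E + coef q m * A). split.
  - apply (is_series_ext (fun k => plus ((coef q k - coef q m) * kern q k m)
                                        (scal (coef q m) (kern q k m)))).
    { intros k. unfold plus, scal; simpl; unfold mult; simpl. ring. }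
    apply (is_series_plus (V := C_NormedModule)); [exact HE|].
    apply (is_series_scal (V := C_NormedModule)). exact HA.
  - eapply Rle_trans; [apply Cmod_triangle|]. rewrite Cmod_mult, Rmult_plus_distr_r.
    apply Rplus_le_compat.
    + eapply Rle_trans; [exact BE|]. right. field. lra.
    + apply Rle_trans with (/ d * (/ (1 - Cmod q) ^ 2 * Cmod q ^ m))%R.
      * apply Rmult_le_compat; try apply Cmod_ge_0; [apply Hd | exact BA].
      * right. field. lra.
Qed.

(** * Recurrences in m *)

(** Summing [coef_kern_telescope] over [k]; the telescoping part contributes
    nothing, because its antiderivative vanishes at [k = 0], through the factor
    [1 - q^(2k)], and at infinity. *)
Lemma coef_kern_series_step (q : C) (m : nat) (B : C) : (0 < Cmod q < 1)%R ->
  is_series (fun k => coef q k * kern q k m) B ->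
  is_series (fun k => coef q k * kern q k (S m))
    ((B * (1 - q ^ (2 * m + 1)) + (coef q (S m) * q ^ (2 * m + 2) - coef q m * q ^ (2 * m + 1)))
      / (1 - q ^ (2 * m + 2))).
Proof.
  intros Hq HB.
  pose proof (one_sub_pow_nz q (2 * m + 2) ltac:(lra) ltac:(lia)) as N.
  destruct (coef_bounds q ltac:(lra)) as [d [d0 Hd]].
  set (g := fun k => coef q k * (1 - q ^ (2 * k)) * kern q k (S m)).
  set (K := (/ d * 2 * (/ (1 - Cmod q) * / Cmod q ^ S m))%R).
  assert (Hg : forall k, (Cmod (g k) <= K * Cmod q ^ k)%R).
  { intros k. unfold g, K. rewrite !Cmod_mult, (Rmult_assoc (/ d * 2)).
    apply Rmult_le_compat; try (apply Rmult_le_pos); try apply Cmod_ge_0;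
      [|apply kern_bound, Hq].
    apply Rmult_le_compat; try apply Cmod_ge_0; [apply Hd|].
    pose proof (Cmod_1_sub (q ^ (2 * k))) as [_ U]. rewrite Cmod_pow in U.
    assert (Cmod q ^ (2 * k) <= 1)%R by (rewrite <- (pow1 (2 * k)); apply pow_incr; lra).
    lra. }
  assert (L : is_lim_seq (fun k => K * Cmod q ^ k)%R 0).
  { apply ex_series_lim_0. eexists. apply (is_series_pow (Cmod q) K). lra. }
  pose proof (is_series_telescope g _ Hg L) as Tg.
  apply (is_series_ext (fun k => scal (/ (1 - q ^ (2 * m + 2)))
    (plus (plus (scal (1 - q ^ (2 * m + 1)) (coef q k * kern q k m)) (g k - g (S k)))
       (plus (if (k =? S m)%nat then coef q (S m) * q ^ (2 * m + 2) else RtoC 0)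
          (opp (if (k =? m)%nat then coef q m * q ^ (2 * m + 1) else RtoC 0)))))).
  { intros k.
    assert (E : coef q k * kern q k (S m)
       = / (1 - q ^ (2 * m + 2)) * (coef q k * kern q k (S m) * (1 - q ^ (2 * m + 2))))
      by (field; exact N).
    rewrite E, coef_kern_telescope by exact Hq. unfold g, scal, plus, opp; cbn -[Nat.mul Cpow Nat.eqb].
    unfold mult; cbn -[Nat.mul Cpow Nat.eqb]. ring. }
  replace (_ / _) with (scal (/ (1 - q ^ (2 * m + 2)))
    (plus (plus (scal (1 - q ^ (2 * m + 1)) B) (g O))
       (plus (coef q (S m) * q ^ (2 * m + 2)) (opp (coef q m * q ^ (2 * m + 1)))))).
  - apply (is_series_scal (V := C_NormedModule)).
    apply (is_series_plus (V := C_NormedModule)); apply (is_series_plus (V := C_NormedModule)).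
    + apply (is_series_scal (V := C_NormedModule)), HB.
    + exact Tg.
    + apply is_series_indicator.
    + apply (is_series_opp (V := C_NormedModule)), is_series_indicator.
  - unfold g. replace (1 - q ^ (2 * 0)) with (RtoC 0) by (simpl; ring).
    unfold scal, plus, opp; cbn -[Nat.mul Cpow].
    unfold mult; cbn -[Nat.mul Cpow]. field. exact N.
Qed.

Lemma qint_nat (p : C) (n : nat) : qint p (Z.of_nat n) = (1 - p ^ n) / (1 - p).
Proof.
  unfold qint, Cpow_Z.
  replace (Z.of_nat n <? 0)%Z with false by (symmetry; apply Z.ltb_ge; lia).
  now rewrite Nat2Z.id.
Qed.

Lemma rhs_term_eq (q : C) (n : nat) : (Cmod q < 1)%R ->
  rhs_term q (S n) = (- (1)) ^ n * q ^ S n * (1 - q) / (1 - q ^ S n).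
Proof.
  intros Hq. unfold rhs_term. rewrite qint_nat.
  replace (S n - 1)%nat with n by lia.
  pose proof (one_sub_pow_nz q (S n) Hq ltac:(lia)).
  pose proof (Cmod_lt_1_sub_nz q Hq). field. auto.
Qed.

Lemma Cpow_m1_even (n : nat) : (- (1)) ^ (2 * n) = 1.
Proof. rewrite Cpow_mult_r. replace ((- (1)) ^ 2) with (RtoC 1) by ring. apply Cpow_1_l. Qed.

Lemma rhs_term_bound (q : C) (n : nat) : (Cmod q < 1)%R ->
  (Cmod (rhs_term q (S n)) <= 2 / (1 - Cmod q) * Cmod q ^ n)%R.
Proof.
  intros Hq. pose proof (Cmod_ge_0 q) as Hq0. rewrite rhs_term_eq by exact Hq.
  rewrite Cmod_div by (apply one_sub_pow_nz; [exact Hq | lia]).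
  rewrite !Cmod_mult, !Cmod_pow, Cmod_m1, pow1.
  pose proof (Cmod_1_sub q) as [_ U].
  pose proof (Cmod_ge_0 (1 - q)) as Z. pose proof (pow_le (Cmod q) n Hq0) as P.
  replace (2 / (1 - Cmod q) * Cmod q ^ n)%R with (Cmod q ^ n * 2 * / (1 - Cmod q))%R
    by (field; lra).
  apply Rmult_le_compat.
  - rewrite Rmult_1_l. apply Rmult_le_pos; [apply pow_le|]; assumption.
  - left. apply Rinv_0_lt_compat. pose proof (Cmod_1_sub_pow q n Hq). lra.
  - rewrite Rmult_1_l. simpl. apply Rmult_le_compat; try lra; nra.
  - apply Rinv_le_contravar; [lra|]. apply Cmod_1_sub_pow, Hq.
Qed.

Lemma rhs_series (q : C) (m : nat) : (Cmod q < 1)%R ->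
  exists T : C, is_series (fun j => rhs_term q (2 * m + 1 + j)) T
    /\ (Cmod T <= 2 / (1 - Cmod q) ^ 2 * Cmod q ^ m)%R.
Proof.
  intros Hq. pose proof (Cmod_ge_0 q) as Hq0.
  assert (B : forall j, (Cmod (rhs_term q (2 * m + 1 + j))
       <= 2 / (1 - Cmod q) * Cmod q ^ m * Cmod q ^ j)%R).
  { intros j. replace (2 * m + 1 + j)%nat with (S (m + m + j)) by lia.
    eapply Rle_trans; [apply rhs_term_bound, Hq|].
    rewrite Rmult_assoc. apply Rmult_le_compat_l.
    - apply Rmult_le_pos; [lra|]. left; apply Rinv_0_lt_compat; lra.
    - rewrite !pow_add. apply Rmult_le_compat_r; [apply pow_le; lra|].
      pose proof (pow_le (Cmod q) m Hq0).
      assert (Cmod q ^ m <= 1)%R by (rewrite <- (pow1 m); apply pow_incr; lra). nra. }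
  pose proof (is_series_pow (Cmod q) (2 / (1 - Cmod q) * Cmod q ^ m) ltac:(lra)) as G.
  destruct (ex_series_Cmod_le _ _ _ B G) as [T HT].
  exists T. split; [exact HT|].
  eapply Rle_trans; [exact (is_series_Cmod_le _ _ _ _ B HT G)|].
  right. field. lra.
Qed.

Lemma rhs_series_step (q : C) (m : nat) (T : C) : (Cmod q < 1)%R ->
  is_series (fun j => rhs_term q (2 * m + 1 + j)) T ->
  is_series (fun j => rhs_term q (2 * S m + 1 + j))
    (T - q ^ (2 * m + 1) * (1 - q) / (1 - q ^ (2 * m + 1))
       + q ^ (2 * m + 2) * (1 - q) / (1 - q ^ (2 * m + 2))).
Proof.
  intros Hq HT. apply is_series_uncons, is_series_uncons in HT.
  replace (T - rhs_term q (2 * m + 1 + 0) - rhs_term q (2 * m + 1 + 1))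
    with (T - q ^ (2 * m + 1) * (1 - q) / (1 - q ^ (2 * m + 1))
       + q ^ (2 * m + 2) * (1 - q) / (1 - q ^ (2 * m + 2))) in HT.
  - eapply is_series_ext; [|exact HT]. intros j. cbv beta. f_equal. lia.
  - replace (2 * m + 1 + 0)%nat with (S (2 * m)) by lia.
    replace (2 * m + 1 + 1)%nat with (S (S (2 * m))) by lia.
    rewrite !rhs_term_eq by exact Hq.
    rewrite (Cpow_S (- (1)) (2 * m)), Cpow_m1_even.
    replace (2 * m + 1)%nat with (S (2 * m)) by lia.
    replace (2 * m + 2)%nat with (S (S (2 * m))) by lia.
    pose proof (one_sub_pow_nz q (S (2 * m)) Hq ltac:(lia)).
    pose proof (one_sub_pow_nz q (S (S (2 * m))) Hq ltac:(lia)).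
    set (x := q ^ S (2 * m)) in *. set (y := q ^ S (S (2 * m))) in *. clearbody x y.
    field. auto.
Qed.

(** * The defect vanishes *)

(** [D] is the difference of the two sides at [m], up to a common factor;
    a relation, as the two sums are themselves specified by [is_series]. *)
Definition defect (q : C) (m : nat) (D : C) : Prop :=
  exists B T : C, is_series (fun k => coef q k * kern q k m) B
    /\ is_series (fun j => rhs_term q (2 * m + 1 + j)) T
    /\ D = (1 - q) * B - coef q m * T.

(** The two boundary terms produced by [coef_kern_series_step] are, after
    division by [c_m (1 - q^(2m+1)) = c_(m+1) (1 - q^(2m+2))], the two terms
    removed from the alternating tail.  So the ratio [x] of the defect to [c_m]
    is preserved. *)
Lemma defect_S (q : C) (m : nat) (x : C) : (0 < Cmod q < 1)%R ->
  defect q m (coef q m * x) -> defect q (S m) (coef q (S m) * x).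
Proof.
  intros Hq (B & T & HB & HT & HD).
  pose proof (coef_kern_series_step q m B Hq HB) as HB'.
  pose proof (rhs_series_step q m T ltac:(lra) HT) as HT'.
  eexists. eexists. split; [exact HB'|]. split; [exact HT'|].
  pose proof (one_sub_pow_nz q (2 * m + 1) ltac:(lra) ltac:(lia)) as N1.
  pose proof (one_sub_pow_nz q (2 * m + 2) ltac:(lra) ltac:(lia)) as N2.
  pose proof (coef_S q m ltac:(lra)) as E.
  set (u := q ^ (2 * m + 1)) in *. set (w := q ^ (2 * m + 2)) in *.
  set (c := coef q m) in *. clearbody u w c.
  replace (coef q (S m)) with (c * (1 - u) / (1 - w)) by (rewrite <- E; field; exact N2).
  transitivity (c * x * (1 - u) / (1 - w)); [field; exact N2|].
  rewrite HD. field. auto.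
Qed.

Lemma defect_bound (q : C) : (0 < Cmod q < 1)%R ->
  exists K, forall m D, defect q m D -> (Cmod D <= K * Cmod q ^ m)%R.
Proof.
  intros Hq. destruct (coef_kern_series q Hq) as [K HK].
  destruct (coef_bounds q ltac:(lra)) as [d [d0 Hd]].
  exists (2 * K + / d * (2 / (1 - Cmod q) ^ 2))%R.
  intros m D (B & T & HB & HT & ->).
  destruct (HK m) as (B' & HB' & KB).
  destruct (rhs_series q m ltac:(lra)) as (T' & HT' & KT).
  assert (EB : B = B') by exact (filterlim_locally_unique (V := C_NormedModule) _ B B' HB HB').
  assert (ET : T = T') by exact (filterlim_locally_unique (V := C_NormedModule) _ T T' HT HT').
  subst B' T'. unfold Cminus.
  eapply Rle_trans; [apply Cmod_triangle|]. rewrite Cmod_opp, !Cmod_mult, Rmult_plus_distr_r.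
  apply Rplus_le_compat; rewrite Rmult_assoc;
    apply Rmult_le_compat; try apply Cmod_ge_0; try assumption; [|apply Hd].
  pose proof (Cmod_1_sub q). unfold Cminus in *. lra.
Qed.

(** The ratio [x = D / c_m] is the same at every later index, where the defect
    is arbitrarily small and [c] is not. *)
Lemma defect_0 (q : C) (m : nat) (D : C) : (0 < Cmod q < 1)%R ->
  defect q m D -> D = 0.
Proof.
  intros Hq HD.
  destruct (coef_bounds q ltac:(lra)) as [d [d0 Hd]].
  destruct (defect_bound q Hq) as [K HK].
  assert (N : coef q m <> 0) by (apply Cmod_gt_0; pose proof (Hd m); lra).
  set (x := D / coef q m).
  assert (E : D = coef q m * x) by (unfold x; field; exact N).
  assert (HI : forall n, defect q (n + m) (coef q (n + m) * x)).
  { induction n as [|n IH]; [simpl; rewrite <- E; exact HD|]. apply defect_S; assumption. }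
  assert (Hb : forall n, (d * Cmod x <= K * Cmod q ^ m * Cmod q ^ n)%R).
  { intros n. specialize (HK _ _ (HI n)). rewrite Cmod_mult, pow_add in HK.
    apply Rle_trans with (Cmod (coef q (n + m)) * Cmod x)%R.
    - apply Rmult_le_compat_r; [apply Cmod_ge_0 | apply Hd].
    - lra. }
  assert (L : is_lim_seq (fun n => K * Cmod q ^ m * Cmod q ^ n)%R 0).
  { apply ex_series_lim_0. eexists. apply (is_series_pow (Cmod q) (K * Cmod q ^ m)). lra. }
  pose proof (is_lim_seq_le _ _ _ _ Hb (is_lim_seq_const _) L) as Z. simpl in Z.
  assert (X : Cmod x = 0%R).
  { pose proof (Cmod_ge_0 x). apply Rle_antisym; [|assumption].
    apply Rmult_le_reg_l with d; lra. }
  rewrite E, (Cmod_eq_0 x X). ring.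
Qed.

(** * The summand of the theorem *)

Lemma qint_sqr_sub (q : C) (k m : nat) : (0 < Cmod q < 1)%R ->
  qint (q ^ 2) (Z.of_nat k - Z.of_nat m)
  = (q ^ (2 * m) - q ^ (2 * k)) / (q ^ (2 * m) * (1 - q ^ 2)).
Proof.
  intros Hq. assert (Hq0 : q <> 0) by (apply Cmod_gt_0; lra).
  pose proof (Cmod_lt_1_sub_nz (q ^ 2) (Cmod_sqr_lt_1 q ltac:(lra))) as N.
  pose proof (Cpow_nz q (2 * m) Hq0). pose proof (Cpow_nz q (2 * k) Hq0).
  unfold qint.
  replace (Cpow_Z (q ^ 2) (Z.of_nat k - Z.of_nat m)) with (q ^ (2 * k) / q ^ (2 * m)).
  - field. auto.
  - unfold Cpow_Z. rewrite <- !Cpow_mult_r.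
    destruct (Z.ltb_spec (Z.of_nat k - Z.of_nat m) 0) as [H1|H1].
    + replace (2 * m)%nat
        with (2 * k + 2 * Z.to_nat (- (Z.of_nat k - Z.of_nat m)))%nat by lia.
      rewrite Cpow_add_r. field. split; apply Cpow_nz, Hq0.
    + replace (2 * k)%nat
        with (2 * m + 2 * Z.to_nat (Z.of_nat k - Z.of_nat m))%nat by lia.
      rewrite Cpow_add_r. field. assumption.
Qed.

Lemma lhs_term_eq (q : C) (m k : nat) : (0 < Cmod q < 1)%R ->
  lhs_term q m k = (1 - q ^ 2) * q ^ m * (coef q k * kern q k m).
Proof.
  intros Hq. unfold lhs_term. destruct (Nat.eqb_spec k m) as [->|H].
  - rewrite kern_diag. ring.
  - assert (Hq0 : q <> 0) by (apply Cmod_gt_0; lra).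
    rewrite qint_sqr_sub by exact Hq.
    rewrite <- qbinom_coef by lra. unfold kern.
    pose proof (pow_even_sub_nz q k m Hq H) as N1.
    pose proof (Cmod_lt_1_sub_nz (q ^ 2) (Cmod_sqr_lt_1 q ltac:(lra))) as N2.
    pose proof (qpoch_opp_nz q (2 * k) ltac:(lra)) as N3.
    pose proof (Cpow_nz q m Hq0) as N4.
    set (b := qbinom _ _ _). set (p := qpoch _ _ _) in *. clearbody b p.
    replace (q ^ (2 * m)) with (q ^ m * q ^ m) in *
      by (rewrite <- Cpow_add_r; f_equal; lia).
    set (z := q ^ (2 * k)) in *. clearbody z.
    rewrite Cpow_add_r. set (s := q ^ 2) in *. clearbody s. field. auto.
Qed.

Theorem theorem1p2 :
  forall (q : C), (0 < Cmod q < 1)%R ->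
  forall (m : nat),
  exists L T : C,
    is_series (fun k : nat => lhs_term q m k) L /\
    is_series (fun j : nat => rhs_term q (2 * m + 1 + j)) T /\
    L = qbinom (q ^ 2) (2 * m) m
        * ((1 + q) * q ^ m / qpoch (- q) q (2 * m)) * T.
Proof.
  intros q Hq m.
  destruct (coef_kern_series q Hq) as [K HK]. destruct (HK m) as (B & HB & _).
  destruct (rhs_series q m ltac:(lra)) as (T & HT & _).
  exists ((1 - q ^ 2) * q ^ m * B), T. split; [|split; [exact HT|]].
  - apply (is_series_ext (fun k => scal ((1 - q ^ 2) * q ^ m) (coef q k * kern q k m))).
    + intros k. symmetry. apply lhs_term_eq, Hq.
    + apply (is_series_scal (V := C_NormedModule)), HB.
  - assert (D : (1 - q) * B - coef q m * T = 0).
    { apply (defect_0 q m); [exact Hq|]. exists B, T. auto. }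
    assert (E : (1 - q) * B = coef q m * T).
    { replace ((1 - q) * B) with ((1 - q) * B - coef q m * T + coef q m * T) by ring.
      rewrite D. ring. }
    transitivity ((1 + q) * q ^ m * ((1 - q) * B)); [ring|].
    rewrite E, <- qbinom_coef by lra.
    field. apply qpoch_opp_nz. lra.
Qed.
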